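(* (i) For each $p\in\{3,5,7,13,19,31,41\}$ there exists a quaternary Legendre pair $(A,B)$ of length $\ell=2p$ whose $2$-compression is the pair $(A_p,B_p)$ of sequences of length $p$ given by $$A_p=\left[0,2\left(\tfrac{1}{p}\right),2\left(\tfrac{2}{p}\right),\ldots,2\left(\tfrac{p-1}{p}\right)\right],\qquad B_p=[1+i,0,\ldots,0],$$ where $\left(\frac{\cdot}{p}\right)$ is the Legendre symbol. (ii) For every positive even integer $\ell\le 24$ there exists a quaternary Legendre pair of length $\ell$.
   Context: Here $i=\sqrt{-1}$. A finite complex sequence $A=[a_0,\ldots,a_{\ell-1}]$ of length $\ell$ is continued periodically with period $\ell$. Its periodic autocorrelation function is $PAF(A,s)=\sum_{j=0}^{\ell-1}a_j\overline{a_{j+s}}$. Two sequences $A,B$ of length $\ell$ form a Legendre pair $(A,B)$ if $PAF(A,s)+PAF(B,s)=-2$ for $s=1,2,\ldots,\lfloor\ell/2\rfloor$ (equivalently for $s=1,\ldots,\ell-1$). It is quaternary if $A,B\in\{-1,1,-i,i\}^\ell$. The $2$-compression of a pair $(A,B)$ of sequences of length $2p$ is the pair of sequences of length $p$ with entries $a_j+a_{j+p}$ and $b_j+b_{j+p}$, $j=0,1,\ldots,p-1$, respectively. *)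

(* Defs.v *)
From HB Require Import structures.
From mathcomp Require Import all_boot all_order all_algebra.
From mathcomp Require Export complex reals.

Set Implicit Arguments.
Unset Strict Implicit.
Unset Printing Implicit Defensive.

Import GRing.Theory Num.Theory.
Local Open Scope ring_scope.

(* For p an odd prime; residues are searched for among 0, ..., p - 1. *)
Definition legendre_symbol (a p : nat) : int :=
  if (p %| a)%N then 0
  else if [exists x : 'I_p, x ^ 2 == a %[mod p]]%N then 1
  else -1.

Section Sequences.
Variable C : numClosedFieldType.

Definition periodic l (A : l.-tuple C) (j : nat) : C := A`_(j %% l).

Definition PAF l (A : l.-tuple C) (s : nat) : C :=
  \sum_(0 <= j < l) periodic A j * (periodic A (j + s))^*.

Definition Legendre_pair l (A B : l.-tuple C) : Prop :=
  forall s : nat, (1 <= s <= l./2)%N -> PAF A s + PAF B s = - 2.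

Definition quaternary l (A : l.-tuple C) : Prop :=
  forall x : C, x \in A -> x \in [:: -1; 1; - 'i; 'i].

Definition quaternary_Legendre_pair l (A B : l.-tuple C) : Prop :=
  [/\ quaternary A, quaternary B & Legendre_pair A B].

Definition compression2 p (AB : (2 * p).-tuple C * (2 * p).-tuple C) :
    p.-tuple C * p.-tuple C :=
  ([tuple AB.1`_j + AB.1`_(j + p) | j < p],
   [tuple AB.2`_j + AB.2`_(j + p) | j < p]).

(* The leading entry is 0, since legendre_symbol 0 p = 0. *)
Definition A_seq p : p.-tuple C :=
  [tuple 2 * (legendre_symbol j p)%:~R | j < p].

Definition B_seq p : p.-tuple C :=
  [tuple (if j == 0%N :> nat then 1 + 'i else 0) | j < p].

End Sequences.

Arguments A_seq C p : clear implicits.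
Arguments B_seq C p : clear implicits.

(* Main.v *)
Require Import Defs.
From mathcomp Require Import all_boot all_order all_algebra.
From mathcomp Require Import complex reals.
From mathcomp Require Import zify ring.

Set Implicit Arguments.
Unset Strict Implicit.
Unset Printing Implicit Defensive.

Import GRing.Theory Num.Theory.

(** The pairs are explicit, with entries i^e recorded by their exponents e
modulo 4. A periodic autocorrelation is then a sum of powers of i, so a pair
is a Legendre pair as soon as, at each lag, the exponent differences satisfy
two equations between the numbers of occurrences of 0, 1, 2 and 3
([Legendre_pairbP]); for given sequences these are checked by evaluation. What
needs an idea is where the sequences come from.

Length 2p with prescribed compression. A pair of length l is a Legendre pair
iff the squared moduli of the two Fourier transforms add up to 2l + 2 at every
nontrivial character of Z/l. For l = 2p, the characters of period p only see
the compressions: there the sequence of doubled Legendre symbols contributes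
4p and the constant 1 + i contributes 2, as required. The other characters
only see the differences a_j - a_(j+p). The compression forces A: its
difference sequence is supported at j = 0, where it has modulus 2, so it
contributes 4. Hence the differences of B have to contribute 4p - 2. Multiply
them by (-1)^j, which turns antiperiodicity into period p, and divide by
1 - i: the result is a sequence c of period p, with c_0 = 1 and all other
entries of the form +-1 +- i, whose transform has squared modulus 2p - 1
everywhere. If c is symmetric, its real and imaginary parts are the first rows
of two symmetric circulants Y and X with Y^2 + X^2 = (2p - 1) I, that is, of a
symmetric conference matrix of order 2p formed from two circulants. When
q = 2p - 1 is a prime power (here 5, 9, 13, 25, 37, 61, 81), Paley's matrix
has this form: with chi the quadratic character of F_q, g of order p in the
multiplicative group of F_(q^2), and delta^q = - delta,
   y_t = chi(2) chi(g^t + g^(-t)),   x_t = chi((g^t - g^(-t)) / delta).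

The remaining even lengths. Lengths 6, 10 and 14 are covered by p = 3, 5, 7.
For l = (q - 1) / 2 with q = 1 modulo 4 a prime power (here 5, 9, 17, 25, 37,
41, 49), let g generate the multiplicative group of F_q and put
   a_k = chi(g^(2k) - 1) for k <> 0, a_0 = i,   b_k = chi(g^(2k+1) - 1).
With 0 in place of a_0 the autocorrelations at lag s add up to the sum of
chi(x - 1) chi(g^(2s) x - 1) over x <> 0, which is -2; restoring a_0 = i adds
i (a_s - a_(-s)), which vanishes because chi(-1) = 1 makes a symmetric.
Lengths 16 and 22 escape both families, as 33, 45 and 21 are not prime powers
and 8 is not prime; there the pair comes from matching compressions whose
transforms have the right squared moduli at the characters of period l/2, and
then choosing the differences a_j - a_(j+l/2) to be right at the others. *)

Local Open Scope ring_scope.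

(** * Autocorrelations of sequences of powers of i *)

Section PowersOfI.
Variable C : numClosedFieldType.

Definition powers l (e : seq nat) : l.-tuple C :=
  [tuple 'i ^+ nth 0%N e j | j < l].

Lemma nth_powers l (e : seq nat) j :
  (j < l)%N -> (powers l e)`_j = 'i ^+ nth 0%N e j.
Proof. by move=> ltjl; rewrite -(tnth_nth _ _ (Ordinal ltjl)) tnth_mktuple. Qed.

Lemma expi_modn4 k : ('i : C) ^+ (k %% 4) = 'i ^+ k.
Proof. by rewrite expr_mod // (exprM 'i 2 2) sqrCi sqrrN expr1n. Qed.

Lemma expi2 : ('i : C) ^+ 2 = -1. Proof. exact: sqrCi. Qed.

Lemma expi3 : ('i : C) ^+ 3 = - 'i.
Proof. by rewrite exprS sqrCi mulrN1. Qed.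

Lemma conj_expi k : (('i : C) ^+ k)^* = 'i ^+ (3 * k).
Proof. by rewrite rmorphXn /= conjCi exprM expi3. Qed.

Lemma expi_add2n k : ('i : C) ^+ (2 + k) = - 'i ^+ k.
Proof. by rewrite exprD expi2 mulN1r. Qed.

Lemma quaternary_powers l e : quaternary (powers l e).
Proof.
move=> _ /tnthP[j ->]; rewrite tnth_mktuple -expi_modn4.
have := ltn_pmod (nth 0%N e j) (isT : (0 < 4)%N).
case: (_ %% 4)%N => [|[|[|[|//]]]] _;
  by rewrite ?expr0 ?expr1 ?expi2 ?expi3 !inE eqxx ?orbT.
Qed.

Lemma sum_expi (s : seq nat) : all (fun k => k < 4)%N s ->
  \sum_(k <- s) ('i : C) ^+ k
    = (count_mem 0%N s)%:R - (count_mem 2 s)%:R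
      + ((count_mem 1%N s)%:R - (count_mem 3 s)%:R) * 'i.
Proof.
elim: s => [_|k s IHs /= /andP[ltk4 /IHs sumE]].
  by rewrite big_nil /= !subr0 mul0r addr0.
rewrite big_cons {}sumE !natrD.
case: k ltk4 => [|[|[|[|//]]]] _ /=; rewrite ?expr0 ?expr1 ?expi2 ?expi3; ring.
Qed.

(** The factor 3 is -1 modulo 4: conjugating a power of i negates its
exponent. *)
Definition lag_exponents l (e : seq nat) (s : nat) : seq nat :=
  [seq (nth 0 e j + 3 * nth 0 e ((j + s) %% l)) %% 4 | j <- iota 0 l]%N.

Lemma PAF_powers l e s :
  PAF (powers l e) s = \sum_(k <- lag_exponents l e s) 'i ^+ k.
Proof.
rewrite /PAF /lag_exponents big_map /index_iota subn0.
rewrite big_seq [RHS]big_seq; apply: eq_bigr => j.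
rewrite mem_iota add0n /= => ltjl.
have l_gt0 : (0 < l)%N by apply: leq_ltn_trans ltjl.
rewrite /periodic modn_small // !nth_powers ?ltn_pmod //.
by rewrite conj_expi -exprD expi_modn4.
Qed.

(** With c_k occurrences of the exponent k among both sequences of differences,
the autocorrelations add up to (c_0 - c_2) + (c_1 - c_3) i, and this has to
be -2. *)
Definition Legendre_pairb l (e f : seq nat) : bool :=
  all (fun s => let d := lag_exponents l e s ++ lag_exponents l f s in
         (count_mem 1 d == count_mem 3 d) &&
         (count_mem 2 d == count_mem 0 d + 2))%N
      (iota 1 l./2).

Lemma Legendre_pairbP l e f :
  Legendre_pairb l e f -> Legendre_pair (powers l e) (powers l f).
Proof.
move=> /allP chk s /andP[s_gt0 s_le].
have /chk : s \in iota 1 l./2 by rewrite mem_iota s_gt0 add1n ltnS.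
move=> /= /andP[/eqP c13 /eqP c02].
rewrite !PAF_powers -big_cat sum_expi ?c13 ?c02; last first.
  by rewrite all_cat !all_map; apply/andP; split; apply/allP=> j _ /=;
     exact: ltn_pmod.
by rewrite natrD; ring.
Qed.

Lemma quaternary_Legendre_pair_powers l e f : Legendre_pairb l e f ->
  quaternary_Legendre_pair (powers l e) (powers l f).
Proof.
by move=> chk; split; [exact: quaternary_powers..|exact: Legendre_pairbP].
Qed.

(** * Pairs of length 2p whose compression is the Legendre sequence *)

(** Quantifying over a list instead of the ordinals below p lets the symbol be
computed by evaluation. *)
Definition is_square_mod (p a : nat) : bool :=
  has (fun x => x ^ 2 == a %[mod p])%N (iota 0 p).

Lemma legendre_symbolE a p :
  legendre_symbol a p
    = if (p %| a)%N then 0 else if is_square_mod p a then 1 else -1.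
Proof.
rewrite /legendre_symbol.
suff -> : [exists x : 'I_p, x ^ 2 == a %[mod p]]%N = is_square_mod p a by [].
apply/existsP/hasP => [[x sqx]|[x]].
  by exists (val x); rewrite ?mem_iota /=.
by rewrite mem_iota add0n => /= ltxp sqx; exists (Ordinal ltxp).
Qed.

(** The compression leaves no choice except for the first entry: two units with
sum 2 or -2 are equal and real, and two with sum 0 are opposite. The first
entry is taken to be 1. *)
Definition legendre_exponents p : seq nat :=
  mkseq (fun j => if p %| j then 2 * (j %/ p)
                  else if is_square_mod p j then 0 else 2)%N (2 * p).

(** Compression to (1 + i, 0, ..., 0) means that b_0, b_p are 1, i in some order
and that b_(j+p) = - b_j elsewhere. Imposing moreover b_(2p-j) = b_j, which is
the symmetry of the underlying conference matrix, leaves the exponents h of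
b_1, ..., b_((p-1)/2) free. *)
Definition antiperiodic_exponents p (h : seq nat) : seq nat :=
  mkseq (fun j => if p %| j then j %/ p
                  else 2 * (j %/ p) +
                    let t := j %% p in
                    if t <= p./2 then nth 0 h t.-1 else nth 0 h (p - t).-1 + 2)%N
        (2 * p).

Lemma compression2_exponents p h :
  compression2 (powers (2 * p) (legendre_exponents p),
                powers (2 * p) (antiperiodic_exponents p h))
    = (A_seq C p, B_seq C p).
Proof.
rewrite /compression2 /A_seq /B_seq /=; congr pair; apply: eq_mktuple => j;
  have ltjp := ltn_ord j; have p_gt0 : (0 < p)%N by apply: leq_ltn_trans ltjp.
all: have lt2 : (j + p < 2 * p)%N by lia.
all: have lt1 : (j < 2 * p)%N by lia.
all: rewrite !nth_powers // !nth_mkseq // dvdn_addl // divnDr // divnn p_gt0.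
  rewrite divn_small // legendre_symbolE.
  have -> : is_square_mod p (j + p) = is_square_mod p j.
    by apply: eq_has => x; rewrite modnDr.
  case: ifP => _; first by rewrite expr0 expi2 subrr mulr0.
  by case: ifP => _; rewrite ?expr0 ?expi2 ?mulr1 ?mulrN1 // -opprD.
rewrite modnDr divn_small // modn_small // /dvdn modn_small //.
case: eqP => _; first by rewrite expr0 expr1.
by rewrite muln1 muln0 add0n expi_add2n subrr.
Qed.

End PowersOfI.

(** The exponents h_t, for t = 1, ..., (p - 1) / 2, are read off from the Paley
conference matrix of order 2p by (-1)^t (1 + i) i^(h_t) = y_t + i x_t. *)
Definition half_exponents (p : nat) : seq nat :=
  match p with
  | 3 => [:: 3]
  | 5 => [:: 3; 2]
  | 7 => [:: 3; 0; 1]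
  | 13 => [:: 3; 3; 1; 2; 3; 2]
  | 19 => [:: 0; 2; 2; 2; 3; 2; 1; 3; 2]
  | 31 => [:: 0; 3; 0; 1; 3; 2; 1; 1; 0; 0; 0; 2; 1; 0; 2]
  | 41 => [:: 3; 3; 0; 3; 1; 0; 1; 2; 3; 2; 3; 0; 2; 2; 2; 0; 3; 3; 1; 0]
  | _ => [::]
  end%N.

Lemma legendre_antiperiodic_pair p :
  p \in [:: 3; 5; 7; 13; 19; 31; 41]%N ->
  Legendre_pairb (2 * p) (legendre_exponents p)
                 (antiperiodic_exponents p (half_exponents p)).
Proof. by move: p; apply/allP; vm_compute. Qed.

(** * Short pairs of the remaining even lengths *)

(** Except at lengths 16 and 22, the single entry 1 is the value i put in place
of chi(0), and the exponents 0 and 2 are the values 1 and -1 of the quadratic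
character. *)
Definition short_exponents (l : nat) : seq nat * seq nat :=
  match l with
  | 2 => ([:: 1; 2], [:: 2; 0])
  | 4 => ([:: 1; 2; 0; 2], [:: 0; 0; 2; 2])
  | 8 => ([:: 1; 0; 2; 2; 0; 2; 2; 0], [:: 0; 2; 2; 2; 0; 0; 0; 2])
  | 12 => ([:: 1; 2; 0; 0; 2; 2; 0; 2; 2; 0; 0; 2],
           [:: 0; 0; 0; 0; 2; 0; 2; 0; 2; 2; 2; 2])
  | 16 => ([:: 2; 3; 2; 0; 0; 3; 0; 3; 2; 3; 1; 2; 0; 1; 1; 1],
           [:: 0; 0; 3; 2; 1; 0; 0; 1; 2; 3; 3; 1; 3; 2; 0; 2])
  | 18 => ([:: 1; 0; 2; 0; 0; 2; 0; 2; 2; 2; 2; 2; 0; 2; 0; 0; 2; 0],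
           [:: 0; 0; 0; 2; 2; 2; 0; 2; 2; 0; 0; 2; 0; 0; 0; 2; 2; 2])
  | 20 => ([:: 1; 2; 2; 2; 0; 0; 2; 0; 2; 0; 0; 0; 2; 0; 2; 0; 0; 2; 2; 2],
           [:: 2; 2; 2; 2; 0; 2; 0; 0; 2; 2; 0; 0; 2; 2; 0; 2; 0; 0; 0; 0])
  | 22 => ([:: 3; 0; 3; 3; 2; 0; 1; 1; 1; 0; 1;
               2; 1; 0; 3; 0; 1; 2; 3; 3; 2; 1],
           [:: 2; 3; 1; 3; 2; 1; 3; 3; 0; 0; 2;
               1; 2; 0; 2; 2; 0; 1; 0; 0; 1; 3])
  | 24 => ([:: 1; 0; 2; 2; 0; 2; 0; 0; 0; 2; 2; 2;
               0; 2; 2; 2; 0; 0; 0; 2; 0; 2; 2; 0],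
           [:: 2; 2; 0; 2; 2; 2; 2; 2; 0; 0; 2; 0;
               2; 0; 2; 2; 0; 0; 0; 0; 0; 2; 0; 0])
  | _ => ([::], [::])
  end%N.

Lemma short_pair l :
  l \in [:: 2; 4; 8; 12; 16; 18; 20; 22; 24]%N ->
  Legendre_pairb l (short_exponents l).1 (short_exponents l).2.
Proof. by move: l; apply/allP; vm_compute. Qed.

Local Close Scope ring_scope.

Theorem mainTheorem4 (R : realType) :
  (forall p : nat, p \in [:: 3; 5; 7; 13; 19; 31; 41] ->
     exists A B : (2 * p).-tuple (complex R),
       quaternary_Legendre_pair A B /\
       compression2 (A, B) = (A_seq (complex R) p, B_seq (complex R) p)) /\
  (forall l : nat, 0 < l -> ~~ odd l -> l <= 24 ->
     exists A B : l.-tuple (complex R), quaternary_Legendre_pair A B).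
Proof.
have pair_2p (p : nat) : p \in [:: 3; 5; 7; 13; 19; 31; 41] ->
    exists A B : (2 * p).-tuple (complex R),
      quaternary_Legendre_pair A B /\
      compression2 (A, B) = (A_seq (complex R) p, B_seq (complex R) p).
  move=> p_in; exists (powers _ (2 * p) (legendre_exponents p)).
  exists (powers _ (2 * p) (antiperiodic_exponents p (half_exponents p))).
  split; last exact: compression2_exponents.
  exact/quaternary_Legendre_pair_powers/legendre_antiperiodic_pair.
split=> // l l_gt0 l_even l_le24.
have : (l \in [:: 6; 10; 14]) || (l \in [:: 2; 4; 8; 12; 16; 18; 20; 22; 24]).
  by move: l l_le24 l_gt0 l_even; do 25!case=> //.
case/orP=> [|/short_pair chk].
  by rewrite !inE => /or3P[] /eqP->;
     [have [//|A [B [ABP _]]] := pair_2p 3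
     |have [//|A [B [ABP _]]] := pair_2p 5
     |have [//|A [B [ABP _]]] := pair_2p 7]; exists A, B.
by exists (powers _ l (short_exponents l).1), (powers _ l (short_exponents l).2);
   exact: quaternary_Legendre_pair_powers.
Qed.
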